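(* Let $G$ be a graph of order $n$ with minimum degree $\delta(G)=3$. Then $$\gamma_g(G)\le \frac{34n}{61}\qquad\text{and}\qquad \gamma_g'(G)\le \frac{34n-27}{61}.$$
   Context: Graphs are finite, simple and undirected; the order of $G=(V,E)$ is $|V|$, and $\delta(G)$ is the minimum degree of $G$. For $v\in V$, $N(v)=\{u: uv\in E\}$ and $N[v]=N(v)\cup\{v\}$; for $S\subseteq V$, $N[S]=\bigcup_{v\in S}N[v]$ is the set of vertices dominated by $S$. The domination game on $G$: two players, Dominator and Staller, alternately select a vertex of $G$. If $D$ is the set of vertices selected so far (by both players), then selecting $v$ is legal if and only if it dominates at least one new vertex, i.e. $N[v]\not\subseteq N[D]$. The game ends when no legal move exists, equivalently when $N[D]=V$. The length of the game is the total number of vertices selected (the number of turns, a turn being one move of one player). Dominator wants to minimize the length and Staller wants to maximize it. The game domination number $\gamma_g(G)$ is the length of the game when Dominator makes the first move and both players play optimally. The Staller-start game domination number $\gamma_g'(G)$ is the length of the game when Staller makes the first move and both players play optimally. *)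

(* Defs.v *)
From mathcomp Require Import all_boot all_order all_algebra.

Set Implicit Arguments.
Unset Strict Implicit.
Unset Printing Implicit Defensive.

Section DominationGame.

(* A finite simple graph: [e] is assumed symmetric and irreflexive wherever
   this matters. *)
Variables (T : finType) (e : rel T).
Implicit Types (v : T) (S D : {set T}).

Definition nbh v : {set T} := [set u | e v u].

Definition cnbh v : {set T} := v |: nbh v.

Definition dominated S : {set T} := \bigcup_(v in S) cnbh v.

(* Degrees are at most #|T|, so the default value only matters when [T] is
   empty. *)
Definition min_degree : nat := \big[minn/#|T|]_(v : T) #|nbh v|.

Definition legal D v : bool := ~~ (cnbh v \subset dominated D).

Inductive player := Dominator | Staller.

(* Minimax value: the number of moves still to be played from the position in
   which the vertices of [D] have been selected and [p] is to move, the game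
   being cut off after [k] more moves. The minimum is taken over a nonempty
   range of values that are at most #|T| (see [game_length_max]), so its
   default value plays no role. *)
Fixpoint moves_left (k : nat) (p : player) D : nat :=
  if k is k'.+1 then
    if [exists v, legal D v] then
      (match p with
       | Dominator =>
           \big[minn/#|T|]_(v | legal D v) moves_left k' Staller (v |: D)
       | Staller =>
           \max_(v | legal D v) moves_left k' Dominator (v |: D)
       end).+1
    else 0
  else 0.

(* Every legal move dominates a new vertex, so at most #|T| moves are ever
   played and the cutoff is harmless: [game_lengthE] is the minimax recursion
   without it. *)
Definition game_length (p : player) D : nat := moves_left #|T| p D.

Definition gamma_g : nat := game_length Dominator set0.

Definition gamma_g' : nat := game_length Staller set0.

Lemma legal_decr D v :
  legal D v -> #|~: dominated (v |: D)| < #|~: dominated D|.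
Proof.
move=> lv; apply: proper_card.
rewrite /dominated bigcup_setU big_set1 -/(dominated D).
by rewrite properE !setCS subsetUr subUset subxx andbT.
Qed.

Lemma legal_existsE D : [exists v, legal D v] = (dominated D != setT).
Proof.
apply/existsP/idP => [[v]|].
  by apply: contraNneq => ->; rewrite subsetT.
rewrite -subTset => /subsetPn[v _ vD]; exists v.
by apply/subsetPn; exists v => //; rewrite setU11.
Qed.

Lemma moves_left_stable k1 k2 p D :
    #|~: dominated D| <= k1 -> #|~: dominated D| <= k2 ->
  moves_left k1 p D = moves_left k2 p D.
Proof.
have over q C k : #|~: dominated C| <= 0 -> 0 = moves_left k q C.
  rewrite leqn0 cards_eq0 -subset0 -setCT setCS subTset => domC.
  by case: k => //= k; rewrite legal_existsE domC.
elim: k1 k2 p D => [|k1 IH] [|k2] p D le1 le2.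
- by [].
- exact: over.
- by symmetry; apply: over.
have IHD q v : legal D v ->
    moves_left k1 q (v |: D) = moves_left k2 q (v |: D).
  by move=> /legal_decr lt; apply: IH; rewrite -ltnS (leq_trans lt).
by rewrite /=; case: p; congr (if _ then _.+1 else _); apply: eq_bigr => v /IHD.
Qed.

Lemma game_lengthE p D :
  game_length p D =
    if dominated D == setT then 0 else
      (match p with
       | Dominator =>
           \big[minn/#|T|]_(v | legal D v) game_length Staller (v |: D)
       | Staller =>
           \max_(v | legal D v) game_length Dominator (v |: D)
       end).+1.
Proof.
rewrite {1}/game_length (@moves_left_stable _ #|T|.+1) ?max_card //; last first.
  by rewrite ltnW // ltnS max_card.
by rewrite /= legal_existsE; case: eqP => //=; case: p.
Qed.

Lemma game_length_max p D : game_length p D <= #|T|.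
Proof.
suff le_k k q C : moves_left k q C <= k by apply: le_k.
elim: k q C => [|k IH] q C //=; case: existsP => // -[v lv]; rewrite ltnS.
case: q.
  apply: leq_trans (IH Staller (v |: C)).
  rewrite -Order.NatOrder.minEnat -Order.NatOrder.leEnat.
  exact: Order.TotalTheory.bigmin_le_cond.
by apply/bigmax_leqP => u _.
Qed.

End DominationGame.

(* Main.v *)
Require Import Defs.
From mathcomp Require Import all_boot all_order all_algebra.
From mathcomp Require Import zify lra.
Set Implicit Arguments.
Unset Strict Implicit.
Unset Printing Implicit Defensive.

Import Order.TTheory GRing.Theory Num.Theory.

(** Call a vertex white while it is not dominated. Give every white vertex
    weight 34 and every dominated vertex a weight [g k], where [k] is its
    number of white neighbours and [g 0 = 0], so that the total weight starts
    at 34 n and ends at 0. It suffices that Dominator can always move so that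
    his move removes weight at least 61, and at least 122 together with
    whatever Staller replies ([potential_bound]). If Staller starts, her first
    move turns a white vertex into weight 0 and at least three white vertices
    into weight at most 16, removing at least 34 + 3 * 18 = 88 = 61 + 27.

    The weight removed by a move is estimated in [selection_gain]: the chosen
    vertex loses all its weight, each of its white neighbours at least 34 - [g t]
    for a bound [t] on its white degree, and the dominated vertices around the
    newly dominated ones lose white neighbours, each loss costing at least the
    least increment [c] of [g]. Since all degrees are at least 3, a newly
    dominated vertex with few white neighbours has many dominated ones, so this
    last term grows as the white degrees drop.

    Two functions [g] are used. As long as some white vertex has at least 3
    white neighbours or some dominated vertex at least 4, take the constant
    weight 16 on all dominated vertices having a white neighbour ([flat]):
    choosing such a vertex removes at least 88, and any reply at least 34. Then
    switch to the weights 9, 13, 16 for 1, 2, and at least 3 white neighbours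
    ([graded]); as [graded] is below [flat], switching only lowers the total.
    Let [m] and [K] bound the white degrees of white and of dominated vertices.
    These bounds never increase, and Dominator keeps attacking a vertex that
    attains one of them (the sums are lower bounds for the weight removed by his
    move and by the reply):
    - (m, K) = (2, 3): a white vertex with 2 white neighbours, 93 + 30;
    - (m, K) = (1, 3): a dominated vertex with 3 white neighbours, 91 + 34;
    - (m, K) = (1, 2): a white vertex with 1 white neighbour, 84 + 38;
    - (m, K) = (0, 2): a dominated vertex with 2 white neighbours, 97 + 43;
    - (m, K) = (0, 1): every move dominates a single vertex and wipes out its
      three or more dominated neighbours as well, at least 34 + 3 * 9 = 61. *)

(** * The potential method for the domination game *)

Section Weights.
Local Open Scope nat_scope.

Variables (T : finType) (e : rel T).
Hypotheses (e_sym : symmetric e) (e_irr : irreflexive e).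
Implicit Types (v x z : T) (D : {set T}) (g : nat -> nat).

Definition white D : {set T} := ~: dominated e D.

Definition wdeg D v : nat := #|nbh e v :&: white D|.

Lemma min_degree_le v : min_degree e <= #|nbh e v|.
Proof.
rewrite -Order.NatOrder.leEnat /min_degree -Order.NatOrder.minEnat.
exact: Order.TotalTheory.bigmin_le_cond.
Qed.

Lemma game_length_Dominator_le D v : legal e D v ->
  game_length e Dominator D <= (game_length e Staller (v |: D)).+1.
Proof.
move=> lv; rewrite game_lengthE; case: eqP => // _.
rewrite ltnS -Order.NatOrder.leEnat -Order.NatOrder.minEnat.
exact: Order.TotalTheory.bigmin_le_cond.
Qed.

Lemma game_length_Staller_reply D :
  game_length e Staller D = 0 \/ exists2 u, legal e D u &
    game_length e Staller D = (game_length e Dominator (u |: D)).+1.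
Proof.
rewrite game_lengthE; case: eqP => [|/eqP]; first by left.
rewrite -legal_existsE => /existsP[u lu]; right.
have [|w lw ->] := @eq_bigmax_cond _ (legal e D)
  (fun w => game_length e Dominator (w |: D)); last by exists w.
by apply/card_gt0P; exists u.
Qed.

(** Weights need only be balanced over a move of Dominator and the reply to it;
    the separate bound [s] on his own move covers the case where it ends the
    game. *)
Lemma potential_bound (phi : {set T} -> nat) s :
    (forall D, dominated e D != setT -> exists v,
      [/\ legal e D v, phi (v |: D) + s <= phi D
        & forall u, legal e (v |: D) u ->
            phi (u |: (v |: D)) + 2 * s <= phi D]) ->
  forall D, s * game_length e Dominator D <= phi D.
Proof.
move=> strategy D; have [n] := ubnP #|white D|.
elim: n D => // n IH D; rewrite ltnS => leD.
have [fin|/strategy[v [lv gain1 gain2]]] := eqVneq (dominated e D) setT.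
  by rewrite game_lengthE fin eqxx muln0.
have ltv : #|white (v |: D)| < #|white D| := legal_decr lv.
have le_v := game_length_Dominator_le lv.
apply: leq_trans (leq_mul (leqnn s) le_v) _.
have [->|[u lu ->]] := game_length_Staller_reply (v |: D); first by lia.
have ltu : #|white (u |: (v |: D))| < #|white (v |: D)| := legal_decr lu.
have := IH (u |: (v |: D)) (leq_trans (ltn_trans ltu ltv) leD).
by have := gain2 u lu; lia.
Qed.

(** * Selecting a vertex *)

Lemma whiteU v D : white (v |: D) = white D :\: cnbh e v.
Proof.
by rewrite /white /dominated bigcup_setU big_set1 setCU setIC -setDE.
Qed.

Lemma whiteS v D : white (v |: D) \subset white D.
Proof. by rewrite whiteU subsetDl. Qed.

Lemma wdegS v D x : wdeg (v |: D) x <= wdeg D x.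
Proof. by rewrite subset_leq_card // setIS // whiteS. Qed.

Lemma legalP D v : legal e D v -> v \in white D \/ 0 < wdeg D v.
Proof.
case/subsetPn => x; rewrite in_setU1 => /orP[/eqP-> | vx] xD.
  by left; rewrite inE.
by right; apply/card_gt0P; exists x; rewrite !inE in vx xD *; rewrite vx.
Qed.

Lemma legal_white D v : v \in white D -> legal e D v.
Proof. by rewrite inE => vD; apply/subsetPn; exists v => //; rewrite setU11. Qed.

Lemma legal_wdeg D v : 0 < wdeg D v -> legal e D v.
Proof.
case/card_gt0P => x; rewrite !inE => /andP[vx xD].
by apply/subsetPn; exists x; rewrite // !inE vx orbT.
Qed.

Definition weight g D v : nat := if v \in white D then 34 else g (wdeg D v).

Definition total_weight g D : nat := \sum_v weight g D v.

Definition bounded D m K : bool :=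
  [forall v, wdeg D v <= if v \in white D then m else K].

(** A white vertex may become dominated, hence the condition [m <= K]. *)
Lemma boundedU v D m K : m <= K -> bounded D m K -> bounded (v |: D) m K.
Proof.
move=> mK /forallP bD; apply/forallP => x.
have := bD x; have := wdegS v D x.
case: (boolP (x \in white (v |: D))) => [/(subsetP (whiteS v D)) ->|_]; first lia.
by case: ifP => _; lia.
Qed.

Lemma selected_weight0 g D v : g 0 = 0 -> weight g (v |: D) v = 0.
Proof.
move=> g0; rewrite /weight whiteU in_setD setU11 /=.
rewrite -[RHS]g0; congr g; apply/eqP; rewrite cards_eq0 whiteU.
apply/eqP/setP => x; rewrite !inE.
by case: (e v x); rewrite ?orbT ?andbF.
Qed.

Definition newly D v : {set T} := cnbh e v :&: white D.

Lemma wdeg_newly D v z :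
  wdeg D z = wdeg (v |: D) z + #|nbh e z :&: newly D v|.
Proof.
rewrite /wdeg -(cardsID (cnbh e v) (nbh e z :&: white D)) addnC.
by rewrite whiteU setIDA /newly [cnbh e v :&: _]setIC setIA.
Qed.

(** Both sides count the edges from newly dominated vertices to vertices, other
    than [v], that were dominated before. *)
Lemma edge_count D v :
  \sum_(z | (z != v) && (z \notin white D)) #|nbh e z :&: newly D v|
  = \sum_(x in newly D v) #|nbh e x :\: white D :\ v|.
Proof.
have indic z (A : {set T}) : #|nbh e z :&: A| = \sum_(x in A) e z x.
  rewrite setIC -sum1_card big_mkcond [RHS]big_mkcond /=; apply: eq_bigr => x _.
  by rewrite !inE; case: (x \in A); case: (e z x).
under eq_bigr => z _ do rewrite indic.
rewrite exchange_big; apply: eq_bigr => x _ /=.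
rewrite -sum1_card big_mkcond [RHS]big_mkcond /=; apply: eq_bigr => z _.
by rewrite !inE e_sym; case: (z != v); case: (z \in dominated e D); case: (e x z).
Qed.

(** The three summands of the gain come from disjoint sets of vertices: [v]
    itself, its white neighbours, and the vertices that were dominated before.
    The last summand is a lower bound for [c] times the number of edges counted
    in [edge_count]. *)
Lemma selection_gain g D v t c r :
    g 0 = 0 -> {homo g : i j / i <= j} -> g t <= 34 ->
    (forall x, x \in white D -> e v x -> wdeg (v |: D) x <= t) ->
    (forall z i j, z \notin white D -> i + j = wdeg D z ->
       g i + c * j <= g (wdeg D z)) ->
    (forall x, x \in newly D v -> r <= #|nbh e x :\: white D :\ v|) ->
  total_weight g (v |: D) + (weight g D v + wdeg D v * (34 - g t)
    + c * (#|newly D v| * r)) <= total_weight g D.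
Proof.
move=> g0 g_mono gt34 le_t slope le_r.
rewrite /total_weight (bigD1 v) //= selected_weight0 // add0n.
rewrite [X in _ <= X](bigD1 v) //=.
rewrite (bigID (mem (white D))) /= [X in _ <= _ + X](bigID (mem (white D))) /=.
have part1 : \sum_(z | (z != v) && (z \in white D)) weight g (v |: D) z
    + wdeg D v * (34 - g t)
    <= \sum_(z | (z != v) && (z \in white D)) weight g D z.
  have -> : wdeg D v * (34 - g t) =
      \sum_(z | (z != v) && (z \in white D)) e v z * (34 - g t).
    rewrite -big_distrl /= /wdeg -sum1_card; congr (_ * _).
    rewrite big_mkcond [RHS]big_mkcond /=; apply: eq_bigr => z _.
    rewrite !inE; case: (eqVneq z v) => [->|_]; first by rewrite e_irr.
    by case: (e v z); case: (z \in dominated e D).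
  rewrite -big_split; apply: leq_sum => z /andP[zv zW] /=.
  rewrite /weight zW whiteU !inE (negPf zv) /=; move: (zW); rewrite inE => ->.
  case vz: (e v z) => /=; last by rewrite mul0n addn0.
  by rewrite mul1n; have := g_mono _ _ (le_t z zW vz); lia.
have part2 : \sum_(z | (z != v) && (z \notin white D)) weight g (v |: D) z
    + c * (#|newly D v| * r)
    <= \sum_(z | (z != v) && (z \notin white D)) weight g D z.
  have le_edges : #|newly D v| * r <=
      \sum_(z | (z != v) && (z \notin white D)) #|nbh e z :&: newly D v|.
    by rewrite edge_count -sum_nat_const; apply: leq_sum => x /le_r.
  apply: (@leq_trans (\sum_(z | (z != v) && (z \notin white D))
      (weight g (v |: D) z + c * #|nbh e z :&: newly D v|))).
    by rewrite big_split leq_add2l -big_distrr leq_mul2l le_edges orbT.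
  apply: leq_sum => z /andP[_ zD].
  have zD' : z \notin white (v |: D) := contra (subsetP (whiteS v D) z) zD.
  by rewrite /weight (negPf zD) (negPf zD') slope // -wdeg_newly.
lia.
Qed.

(** * The gain of a move when white degrees are bounded *)

(** The last condition bounds the increments of [g] up to [K] from below by
    [c]: losing [j] white neighbours costs at least [c * j]. *)
Definition admissible g K c : Prop :=
  [/\ g 0 = 0, {homo g : i j / i <= j}, forall k, g k <= 34
    & forall i j, i + j <= K -> g i + c * j <= g (i + j)].

Section Stage.
Variables (g : nat -> nat) (D : {set T}) (m K c : nat).
Hypotheses (deg3 : forall v, 3 <= #|nbh e v|).
Hypotheses (g_adm : admissible g K c) (D_bounded : bounded D m K).

Lemma slope_dominated z i j : z \notin white D -> i + j = wdeg D z ->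
  g i + c * j <= g (wdeg D z).
Proof.
move=> zD eij; have [_ _ _ g_slope] := g_adm; rewrite -eij g_slope //.
by have := forallP D_bounded z; rewrite eij (negPf zD).
Qed.

Lemma wdeg_white x : x \in white D -> wdeg D x <= m.
Proof. by move=> xW; have := forallP D_bounded x; rewrite xW. Qed.

Lemma dominated_nbh x : x \in white D -> 3 - m <= #|nbh e x :\: white D|.
Proof.
move=> /wdeg_white; rewrite /wdeg => le_m.
by have := cardsID (white D) (nbh e x); have := deg3 x; lia.
Qed.

(** The white neighbours of a white [v] lose at least the neighbour [v], which
    explains [m.-1]; [v] and these neighbours are newly dominated, and each
    has at least [3 - m] dominated neighbours. *)
Lemma white_gain v : v \in white D ->
  total_weight g (v |: D) + (34 + wdeg D v * (34 - g m.-1)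
    + c * ((wdeg D v).+1 * (3 - m))) <= total_weight g D.
Proof.
move=> vW; have [g0 g_mono g34 _] := g_adm.
have -> : (wdeg D v).+1 = #|newly D v|.
  by rewrite /newly setIUl (setIidPl _) ?sub1set // cardsU1 !inE e_irr.
have := @selection_gain g D v m.-1 c (3 - m) g0 g_mono (g34 _).
rewrite /weight vW; apply.
- move=> x xW vx; have := wdeg_white xW; rewrite (wdeg_newly D v).
  suff : 0 < #|nbh e x :&: newly D v| by lia.
  by apply/card_gt0P; exists v; rewrite !inE e_sym vx eqxx; rewrite inE in vW.
- exact: slope_dominated.
- move=> x; rewrite inE => /andP[_ /dominated_nbh].
  suff -> : nbh e x :\: white D :\ v = nbh e x :\: white D by [].
  by apply/setDidPl; rewrite disjoint_sym disjoints1 inE vW.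
Qed.

(** One of the dominated neighbours of each newly dominated vertex is [v]
    itself, whose weight is already counted in full; this leaves [2 - m]. *)
Lemma dominated_gain v : v \notin white D ->
  total_weight g (v |: D) + (g (wdeg D v) + wdeg D v * (34 - g m)
    + c * (wdeg D v * (2 - m))) <= total_weight g D.
Proof.
move=> vD; have [g0 g_mono g34 _] := g_adm.
have {3}-> : wdeg D v = #|newly D v|.
  rewrite /newly setIUl (_ : [set v] :&: _ = set0) ?set0U //.
  by apply/eqP; rewrite setI_eq0 disjoints1.
have := @selection_gain g D v m c (2 - m) g0 g_mono (g34 _).
rewrite /weight (negPf vD); apply.
- by move=> x /wdeg_white le_m _; apply: leq_trans le_m; apply: wdegS.
- exact: slope_dominated.
- move=> x; rewrite inE => /andP[_ /dominated_nbh].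
  by rewrite (cardsD1 v (nbh e x :\: white D)); case: (_ \in _); lia.
Qed.

Lemma any_gain a v :
    a <= 34 + c * (3 - m) ->
    (forall k, 0 < k <= K -> a <= g k + k * (34 - g m) + c * (k * (2 - m))) ->
  legal e D v -> total_weight g (v |: D) + a <= total_weight g D.
Proof.
move=> a_white a_dominated lv.
have [vW|vD] := boolP (v \in white D).
  by apply: leq_trans (white_gain vW); rewrite leq_add2l; nia.
have [|k0] := legalP lv; first by rewrite (negPf vD).
apply: leq_trans (dominated_gain vD); rewrite leq_add2l a_dominated // k0.
by have := forallP D_bounded v; rewrite (negPf vD).
Qed.

End Stage.

(** * The two weight functions *)

Definition flat k : nat := 16 * (0 < k).

(** The value 9 makes an isolated white vertex together with three dominated
    neighbours worth 34 + 3 * 9 = 61, and 16 makes the choice of a white vertex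
    with three white neighbours worth 34 + 3 * 18 = 122 - 34 in the first phase.
    The increment from 9 to 13 is least possible for the stage (1, 2): there a
    reply to a gain of 68 + 4 * 4 may gain only 34 + 4. *)
Definition graded k : nat := nth 16 [:: 0; 9; 13] k.

Lemma gradedE k : graded k =
  match k with 0 => 0 | 1 => 9 | 2 => 13 | _ => 16 end.
Proof. by case: k => [|[|[|[|k]]]]. Qed.

Lemma flat_admissible K : admissible flat K 0.
Proof.
by rewrite /flat; split=> [|i j|k|i j _]; rewrite ?addn0; lia.
Qed.

Lemma graded_admissible K c :
    (forall i j, i + j <= K -> graded i + c * j <= graded (i + j)) ->
  admissible graded K c.
Proof.
split=> // [|k]; last by rewrite gradedE; case: k => [|[|[|k]]].
by move=> [|[|[|i]]] [|[|[|j]]] //; rewrite !gradedE.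
Qed.

Lemma graded_admissible3 : admissible graded 3 3.
Proof. by apply: graded_admissible => -[|[|[|[|i]]]] [|[|[|[|j]]]]. Qed.

Lemma graded_admissible2 : admissible graded 2 4.
Proof. by apply: graded_admissible => -[|[|[|i]]] [|[|[|j]]]. Qed.

Lemma graded_admissible1 : admissible graded 1 9.
Proof. by apply: graded_admissible => -[|[|i]] [|[|j]]. Qed.

Lemma graded_le_flat k : graded k <= flat k.
Proof. by rewrite gradedE /flat; case: k => [|[|[|k]]]. Qed.

Lemma total_weight_le g1 g2 D :
  (forall k, g1 k <= g2 k) -> total_weight g1 D <= total_weight g2 D.
Proof.
by move=> le12; apply: leq_sum => v _; rewrite /weight; case: ifP.
Qed.

(** Changing the weight function in the course of the game is harmless because
    [bounded D 2 3] persists once it holds and [graded] is below [flat]. *)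
Definition potential D : nat :=
  total_weight (if bounded D 2 3 then graded else flat) D.

Lemma potential_le_flat D : potential D <= total_weight flat D.
Proof.
by rewrite /potential; case: ifP => _ //; apply: total_weight_le graded_le_flat.
Qed.

(** * The strategy of Dominator *)

Section Strategy.
Hypothesis deg3 : forall v, 3 <= #|nbh e v|.

Lemma bounded_max D : bounded D #|T| #|T|.
Proof. by apply/forallP => v; rewrite if_same max_card. Qed.

Lemma flat_gain_white D v : v \in white D ->
  total_weight flat (v |: D) + (34 + wdeg D v * 18) <= total_weight flat D.
Proof.
move=> /(white_gain deg3 (flat_admissible _) (bounded_max D)); apply: leq_trans.
by rewrite /flat; nia.
Qed.

Lemma flat_gain_dominated D v : v \notin white D ->
  total_weight flat (v |: D) + (flat (wdeg D v) + wdeg D v * 18)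
    <= total_weight flat D.
Proof.
move=> /(dominated_gain deg3 (flat_admissible _) (bounded_max D)); apply: leq_trans.
by rewrite /flat; nia.
Qed.

Lemma flat_gain D v : legal e D v ->
  total_weight flat (v |: D) + 34 <= total_weight flat D.
Proof.
apply: (any_gain deg3 (flat_admissible _) (bounded_max D)) => // k.
by rewrite /flat; lia.
Qed.

Definition good_move (phi : {set T} -> nat) D v : Prop :=
  [/\ legal e D v, phi (v |: D) + 61 <= phi D
    & forall u, legal e (v |: D) u -> phi (u |: (v |: D)) + 2 * 61 <= phi D].

Lemma good_moveI g D v a b :
    legal e D v -> total_weight g (v |: D) + a <= total_weight g D ->
    (forall u, legal e (v |: D) u ->
       total_weight g (u |: (v |: D)) + b <= total_weight g (v |: D)) ->
    61 <= a -> 122 <= a + b ->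
  good_move (total_weight g) D v.
Proof.
move=> lv gain_v gain_u a61 ab; split=> // [|u /gain_u]; lia.
Qed.

(** The white degrees in [big_v] are the least ones for which both kinds of
    vertices gain 88, as 34 + 3 * 18 = 16 + 4 * 18. *)
Lemma good_move_flat D : ~~ bounded D 2 3 ->
  exists v, good_move (total_weight flat) D v.
Proof.
case/forallPn => v; rewrite -ltnNge => big_v; exists v.
have lv : legal e D v by apply: legal_wdeg; lia.
apply: (@good_moveI _ _ _ 88 34) => //; last by move=> u; apply: flat_gain.
case: ifP big_v => [vW|/negbT vD] big_v.
  by have := flat_gain_white vW; lia.
by have := flat_gain_dominated vD; rewrite /flat; lia.
Qed.

(** A bound that cannot be lowered by one is attained; lowering the bounds in
    the order (2, 3), (1, 3), (1, 2), (0, 2), (0, 1) makes the vertex attaining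
    the bound a good choice at every stage. *)
Lemma good_move_graded D : bounded D 2 3 -> dominated e D != setT ->
  exists v, good_move (total_weight graded) D v.
Proof.
move=> D23 unfinished.
have [D13|] := boolP (bounded D 1 3); last first.
  case/forallPn => v; have := forallP D23 v; rewrite -ltnNge.
  case: ifP => [vW le2 ge2|_]; last by lia.
  have wv : wdeg D v = 2 by lia.
  exists v; apply: (@good_moveI _ _ _ 93 30) => //.
  - exact: legal_white.
  - by have := white_gain deg3 graded_admissible3 D23 vW; rewrite wv.
  - move=> u; apply: (any_gain deg3 graded_admissible3 (boundedU v _ D23)) => //.
    by move=> [|[|[|[|k]]]].
have [D12|] := boolP (bounded D 1 2); last first.
  case/forallPn => v; have := forallP D13 v; rewrite -ltnNge.
  case: ifP => [_|/negbT vD le3 ge3]; first by lia.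
  have wv : wdeg D v = 3 by lia.
  exists v; apply: (@good_moveI _ _ _ 91 34) => //.
  - by apply: legal_wdeg; rewrite wv.
  - have := dominated_gain deg3 graded_admissible3 D13 vD.
    by rewrite wv !gradedE; lia.
  - move=> u; apply: (any_gain deg3 graded_admissible3 (boundedU v _ D13)) => //.
    by move=> [|[|[|[|k]]]].
have [D02|] := boolP (bounded D 0 2); last first.
  case/forallPn => v; have := forallP D12 v; rewrite -ltnNge.
  case: ifP => [vW le1 ge1|_]; last by lia.
  have wv : wdeg D v = 1 by lia.
  exists v; apply: (@good_moveI _ _ _ 84 38) => //.
  - exact: legal_white.
  - by have := white_gain deg3 graded_admissible2 D12 vW; rewrite wv.
  - move=> u; apply: (any_gain deg3 graded_admissible2 (boundedU v _ D12)) => //.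
    by move=> [|[|[|k]]].
have [D01|] := boolP (bounded D 0 1); last first.
  case/forallPn => v; have := forallP D02 v; rewrite -ltnNge.
  case: ifP => [_|/negbT vD le2 ge2]; first by lia.
  have wv : wdeg D v = 2 by lia.
  exists v; apply: (@good_moveI _ _ _ 97 43) => //.
  - by apply: legal_wdeg; rewrite wv.
  - have := dominated_gain deg3 graded_admissible2 D02 vD.
    by rewrite wv !gradedE; lia.
  - move=> u; apply: (any_gain deg3 graded_admissible2 (boundedU v _ D02)) => //.
    by move=> [|[|[|k]]].
move: unfinished; rewrite -legal_existsE => /existsP[v lv].
have gain C u : bounded C 0 1 -> legal e C u ->
    total_weight graded (u |: C) + 61 <= total_weight graded C.
  move=> C01; apply: (any_gain deg3 graded_admissible1 C01) => //.
  by move=> [|[|k]].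
exists v; apply: (@good_moveI _ _ _ 61 61) => //; first exact: gain.
by move=> u; apply: gain; apply: boundedU.
Qed.

Lemma good_move_potential D : dominated e D != setT ->
  exists v, good_move potential D v.
Proof.
move=> unfinished; have [D23|D23] := boolP (bounded D 2 3).
  have [v [lv gain1 gain2]] := good_move_graded D23 unfinished; exists v.
  have vD23 : bounded (v |: D) 2 3 by apply: boundedU.
  rewrite /good_move /potential D23 vD23; split=> // u lu.
  by rewrite boundedU // gain2.
have [v [lv gain1 gain2]] := good_move_flat D23; exists v.
rewrite /good_move {2 4}/potential (negPf D23); split=> // [|u /gain2].
  by have := potential_le_flat (v |: D); lia.
by have := potential_le_flat (u |: (v |: D)); lia.
Qed.

Lemma Dominator_bound D : 61 * game_length e Dominator D <= potential D.
Proof. exact: potential_bound good_move_potential D. Qed.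

Lemma total_weight_set0 g : total_weight g set0 = 34 * #|T|.
Proof.
rewrite /total_weight (eq_bigr (fun=> 34)) ?sum_nat_const 1?mulnC // => v _.
by rewrite /weight inE /dominated big_set0 inE.
Qed.

Lemma gamma_g_bound : 61 * gamma_g e <= 34 * #|T|.
Proof.
rewrite -(total_weight_set0 flat).
exact: leq_trans (Dominator_bound _) (potential_le_flat _).
Qed.

Lemma gamma_g'_bound : 0 < #|T| -> 61 * gamma_g' e + 27 <= 34 * #|T|.
Proof.
move=> T0; have [|[v lv]] := game_length_Staller_reply set0;
  rewrite -/(gamma_g' e) => ->; first by lia.
have vW : v \in white set0 by rewrite inE /dominated big_set0 inE.
have := flat_gain_white vW; rewrite total_weight_set0.
have -> : wdeg set0 v = #|nbh e v|.
  by rewrite /wdeg /white /dominated big_set0 setC0 setIT.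
have := Dominator_bound (v |: set0); have := potential_le_flat (v |: set0).
by have := deg3 v; lia.
Qed.

End Strategy.
End Weights.

Local Open Scope ring_scope.

Theorem theorem1 (T : finType) (e : rel T)
    (e_sym : symmetric e) (e_irr : irreflexive e)
    (e_mindeg : min_degree e = 3%N) :
  ((gamma_g e)%:R <= 34 * #|T|%:R / 61 :> rat) /\
  ((gamma_g' e)%:R <= (34 * #|T|%:R - 27) / 61 :> rat).
Proof.
have deg3 v : (3 <= #|nbh e v|)%N by rewrite -e_mindeg min_degree_le.
have T_gt0 : (0 < #|T|)%N.
  rewrite lt0n; apply: contraPneq e_mindeg => /card0_eq T0.
  rewrite /min_degree big_pred0 => [|v]; last exact: T0.
  by rewrite eq_card0.
have := gamma_g_bound e_sym e_irr deg3; rewrite -(ler_nat rat) !natrM.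
have := gamma_g'_bound e_sym e_irr deg3 T_gt0.
by rewrite -(ler_nat rat) natrD !natrM => staller dominator; split; lra.
Qed.
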